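(* For a complex valued random variable $X$, taking values in the discrete set $\mathcal{X}=\{x_i\}_{i=1}^d$, and for any permutation invariant vector norm $\|\cdot\|$ on $\mathbb{C}^d$, $$\sqrt{\mathrm{Var}(X)} \le r(\mathcal{X}) \le \tfrac12\|\mathcal{X}\|_{(2)} \le \frac{\|\mathcal{X}\|}{\|F\|},$$ where $\mathcal{X}$ has been interpreted as a vector in $\mathbb{C}^d$, and $F=(1,1,0,\dots,0)$.
   Context: If $X$ takes the value $x_i\in\mathbb{C}$ with probability $p_i$, then $\mathrm{Var}(X)=\sum_i p_i|x_i|^2-\big|\sum_i p_ix_i\big|^2$. The radius $r(\mathcal{X})$ is the radius of the smallest circle circumscribing (enclosing) the set of points $\mathcal{X}$ in the complex plane, i.e. $r(\mathcal{X})=\min_{y\in\mathbb{C}}\max_i|x_i-y|$. The set $\mathcal{X}$ is identified with the vector $(x_1,\dots,x_d)\in\mathbb{C}^d$, and $\|\mathcal{X}\|_{(2)}$ is the sum of the two largest values among the moduli $|x_1|,\dots,|x_d|$ (counted with multiplicity). A norm on $\mathbb{C}^d$ is permutation invariant if its value is unchanged under permuting the coordinates. The vector $F\in\mathbb{C}^d$ has its first two entries equal to 1 and all others equal to 0.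
   Formalization: The norm is additionally assumed absolute (it depends only on the moduli of the entries): with permutation invariance alone the last inequality fails, e.g. for d=2, ‖(a,b)‖=2|a+b|+|a−b| and X=(1,−1). Also d≥2 is assumed so that F makes sense. *)

(* Defs.v *)
From HB Require Import structures.
From mathcomp Require Import all_boot all_order all_fingroup all_algebra.
From mathcomp Require Import all_classical all_reals all_analysis.
From mathcomp Require Import complex.

Set Implicit Arguments.
Unset Strict Implicit.
Unset Printing Implicit Defensive.

Import Order.TTheory GRing.Theory Num.Theory.
Import numFieldNormedType.Exports.

Local Open Scope classical_set_scope.
Local Open Scope ring_scope.
Local Open Scope complex_scope.

(* On R[i], `|z| is again an element of R[i]; Normc.normc z is the modulus as
   an element of R. *)

Definition is_distr (R : realType) (d : nat) (p : 'I_d -> R) : Prop :=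
  (forall i, 0 <= p i) /\ \sum_(i < d) p i = 1.

(* Variance of the random variable with value x 0 i with probability p i; the
   entries of x may coincide. *)
Definition complex_variance (R : realType) (d : nat) (p : 'I_d -> R)
    (x : 'rV[R[i]]_d) : R :=
  \sum_(i < d) p i * Normc.normc (x 0 i) ^+ 2
  - Normc.normc (\sum_(i < d) (p i)%:C * x 0 i) ^+ 2.

(* For d > 0 the default value 0 of the iterated maximum is harmless, since the
   moduli are nonnegative. *)
Definition max_dist (R : realType) (d : nat) (x : 'rV[R[i]]_d) (y : R[i]) : R :=
  \big[Num.max/0]_(i < d) Normc.normc (x 0 i - y).

(* The infimum is a minimum: see enclosing_radius_le and
   enclosing_radius_attained below. *)
Definition enclosing_radius (R : realType) (d : nat) (x : 'rV[R[i]]_d) : R :=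
  inf [set max_dist x y | y in [set: R[i]]].

(* Sum of the two largest moduli, counted with multiplicity. *)
Definition kyfan2 (R : realType) (d : nat) (x : 'rV[R[i]]_d) : R :=
  let s := sort >=%O [seq Normc.normc (x 0 i) | i : 'I_d] in s`_0 + s`_1.

Record is_vnorm (R : realType) (d : nat) (N : 'rV[R[i]]_d -> R) : Prop := {
  vnorm_eq0 : forall x, N x = 0 -> x = 0;
  vnormZ : forall (a : R[i]) x, N (a *: x) = Normc.normc a * N x;
  vnormD : forall x y, N (x + y) <= N x + N y
}.

Definition perm_invariant (R : realType) (d : nat)
    (N : 'rV[R[i]]_d -> R) : Prop :=
  forall (s : 'S_d) x, N (col_perm s x) = N x.

(* Together with permutation invariance: N is a symmetric gauge function.
   Permutation invariance alone does not give
   2^-1 * kyfan2 x <= N x / N (Fvec R d): take d = 2,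
   N (a, b) = 2 * |a + b| + |a - b| and x = (1, -1). *)
Definition absolute (R : realType) (d : nat) (N : 'rV[R[i]]_d -> R) : Prop :=
  forall x, N (map_mx (fun z => (Normc.normc z)%:C) x) = N x.

Definition Fvec (R : realType) (d : nat) : 'rV[R[i]]_d :=
  \row_(j < d) (if (j < 2)%N then 1 else 0).

Lemma normc_ge0 (R : realType) (z : R[i]) : 0 <= Normc.normc z.
Proof. by case: z => a b; exact: sqrtr_ge0. Qed.

Lemma max_dist_ge0 (R : realType) d (x : 'rV[R[i]]_d) y : 0 <= max_dist x y.
Proof. by apply: bigmax_ge_id. Qed.

Lemma enclosing_radius_le (R : realType) d (x : 'rV[R[i]]_d) y :
  enclosing_radius x <= max_dist x y.
Proof.
apply: ge_inf; last by exists y.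
by exists 0 => _ [z _ <-]; exact: max_dist_ge0.
Qed.

Lemma max_dist_continuous (R : realType) d (x : 'rV[R[i]]_d) :
  continuous (fun u : R * R => max_dist x (u.1 +i* u.2)).
Proof.
rewrite /max_dist; elim: (index_enum _) => [|i s IHs].
  by move=> u; under eq_fun do rewrite big_nil; exact: cvg_cst.
under eq_fun do rewrite big_cons.
move=> u; apply: (@continuous_max R (R * R)%type
   (fun u => Normc.normc (x 0 i - (u.1 +i* u.2)))
   (fun u => \big[Num.max/0]_(j <- s) Normc.normc (x 0 j - (u.1 +i* u.2))));
  last exact: IHs.
case: (x 0 i) => a b /=.
apply: (@continuous_comp _ _ _
  (fun u : R * R => (a - u.1) ^+ 2 + (b - u.2) ^+ 2) Num.sqrt).
  have H (c : R) (f : R * R -> R) : {for u, continuous f} ->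
      {for u, continuous (fun u => (c - f u) ^+ 2)}.
    move=> cf; apply: (@continuous_comp _ _ _
      (fun u => c - f u) (fun t => t ^+ 2)); last exact: exprn_continuous.
    by apply: continuousB; [exact: cvg_cst | exact: cf].
  apply: continuousD; apply: H; [exact: cvg_fst | exact: cvg_snd].
exact: sqrt_continuous.
Qed.

Lemma enclosing_radius_attained (R : realType) d (x : 'rV[R[i]]_d) :
  exists y, enclosing_radius x = max_dist x y.
Proof.
suff [y Hy] : exists y, forall z, max_dist x y <= max_dist x z.
  exists y; apply/le_anti; rewrite enclosing_radius_le /=.
  apply: lb_le_inf; first by exists (max_dist x 0), 0.
  by move=> _ [z _ <-].
case: d x => [|d] x; first by exists 0 => z; rewrite /max_dist !big_ord0.
have normE (a b : R) : `|a| <= Normc.normc (a +i* b) /\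
    `|b| <= Normc.normc (a +i* b).
  by rewrite -!sqrtr_sqr /=; split; apply: ler_wsqrtr;
    rewrite ?lerDl ?lerDr sqr_ge0.
case Ex: (x 0 0) => [a b].
set M := max_dist x (a +i* b).
set A := `[a - M, a + M] `*` `[b - M, b + M].
have M0 : 0 <= M by exact: max_dist_ge0.
have Aab : A (a, b).
  by split; rewrite /= in_itv /= lerDl gerBl M0.
have cA : compact A by apply: compact_setX; exact: segment_compact.
have cf : {within A, continuous (fun u : R * R => max_dist x (u.1 +i* u.2))}.
  by apply: continuous_subspaceT; exact: max_dist_continuous.
have [c _ Hc] := compact_EVT_min (ex_intro _ _ Aab) cA cf.
exists (c.1 +i* c.2) => -[z1 z2].
have [zA|zA] := pselect (A (z1, z2)).
  by apply: (Hc (z1, z2)); exact: mem_set.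
apply: (le_trans (Hc (a, b) (mem_set Aab))).
rewrite leNgt; apply/negP => lt; apply: zA.
have le0 : Normc.normc (x 0 0 - (z1 +i* z2)) <= max_dist x (z1 +i* z2).
  by rewrite /max_dist; apply: (le_bigmax_cond _ (fun i : 'I_d.+1 =>
    Normc.normc (x 0 i - (z1 +i* z2)))).
have [H1 H2] := normE (a - z1) (b - z2).
rewrite Ex in le0.
have lt' := le_lt_trans le0 lt.
split; rewrite /= in_itv /=.
  by rewrite -ler_distlC; apply: ltW; apply: le_lt_trans H1 lt'.
by rewrite -ler_distlC; apply: ltW; apply: le_lt_trans H2 lt'.
Qed.

(* Main.v *)
Require Import Defs.
From mathcomp Require Import all_boot all_order all_fingroup all_algebra.
From mathcomp Require Import all_classical all_reals all_analysis.
From mathcomp Require Import complex.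
From mathcomp Require Import ring lra.

(** Three independent estimates make up the chain.

    Variance against radius: by the parallel axis identity
    [complex_varianceE], recentring a distribution at y changes its second
    moment by |E X - y|^2, so Var X <= E |X - y|^2 <= max_i |x_i - y|^2 for
    every y, in particular for the centre of the smallest enclosing circle.

    Radius against the two largest moduli a >= b: in
    [radius_le_half_kyfan2], the disc of radius (a + b)/2 whose centre lies at
    distance (a - b)/2 from 0 on the ray through the point of modulus a
    contains that point, on its boundary, and also the whole disc of radius b
    around 0, hence all the other points.

    Two largest moduli against a symmetric gauge N: averaging x over a group of
    isometries of N can only decrease N.  Changing the signs of all coordinates
    but two averages the others to 0, and exchanging the remaining two averages
    (a, b, 0, ...) to (a + b)/2 F; this is [symmetric_gauge_ge_pair].

    The last two estimates refer to the two largest coordinates;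
    [decreasing_rearrangement] turns the sorted list of moduli that defines
    their sum into a permutation of the coordinates. *)

Set Implicit Arguments.
Unset Strict Implicit.
Unset Printing Implicit Defensive.

Import Order.TTheory GRing.Theory Num.Theory.

Local Open Scope ring_scope.
Local Open Scope complex_scope.

Lemma sqr_normcE (R : realType) (z : R[i]) :
  Normc.normc z ^+ 2 = complex.Re z ^+ 2 + complex.Im z ^+ 2.
Proof. by case: z => a b; rewrite sqr_sqrtr ?addr_ge0 ?sqr_ge0. Qed.

Lemma normc_real (R : realType) (a : R) : 0 <= a -> Normc.normc a%:C = a.
Proof. by move=> a0; rewrite /= expr0n addr0 sqrtr_sqr ger0_norm. Qed.

(** [normcN] and [le_normcD] are stated for the copy [Rcomplex R] of R[i], whose
    operations do not match those of R[i] syntactically; this lemma and the next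
    one restate them on R[i]. *)
Lemma normc_opp (R : realType) (z : R[i]) : Normc.normc (- z) = Normc.normc z.
Proof. exact: normcN. Qed.

Lemma normc_triangle (R : realType) (z w : R[i]) :
  Normc.normc (z + w) <= Normc.normc z + Normc.normc w.
Proof. exact: le_normcD. Qed.

Lemma weighted_sum_sqr_shift (R : comRingType) d (p : 'I_d -> R)
    (hp : \sum_(i < d) p i = 1) (a : 'I_d -> R) (u : R) :
  \sum_(i < d) p i * (a i - u) ^+ 2 - (\sum_(i < d) p i * a i - u) ^+ 2 =
  \sum_(i < d) p i * a i ^+ 2 - (\sum_(i < d) p i * a i) ^+ 2.
Proof.
have -> : \sum_(i < d) p i * (a i - u) ^+ 2 =
    \sum_(i < d) p i * a i ^+ 2 - 2 * u * (\sum_(i < d) p i * a i)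
    + u ^+ 2 * \sum_(i < d) p i.
  by rewrite !mulr_sumr -sumrB -big_split; apply: eq_bigr => i _ /=; ring.
rewrite hp; ring.
Qed.

(** The parallel axis (Huygens-Steiner) identity.  The squared modulus splits
    into the squares of the real and imaginary parts, so it follows from the
    real identity applied to each part. *)
Lemma complex_varianceE (R : realType) d (p : 'I_d -> R) (hp : is_distr p)
    (x : 'rV[R[i]]_d) (y : R[i]) :
  complex_variance p x =
  \sum_(i < d) p i * Normc.normc (x 0 i - y) ^+ 2
  - Normc.normc (\sum_(i < d) (p i)%:C * x 0 i - y) ^+ 2.
Proof.
case: hp => _ hp; rewrite /complex_variance.
have ReE : complex.Re (\sum_(i < d) (p i)%:C * x 0 i) =
    \sum_(i < d) p i * complex.Re (x 0 i).
  rewrite raddf_sum; apply: eq_bigr => i _.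
  by case: (x 0 i) => a b /=; ring.
have ImE : complex.Im (\sum_(i < d) (p i)%:C * x 0 i) =
    \sum_(i < d) p i * complex.Im (x 0 i).
  rewrite raddf_sum; apply: eq_bigr => i _.
  by case: (x 0 i) => a b /=; ring.
have splitE (z : R[i]) : \sum_(i < d) p i * Normc.normc (x 0 i - z) ^+ 2 =
    \sum_(i < d) p i * (complex.Re (x 0 i) - complex.Re z) ^+ 2
    + \sum_(i < d) p i * (complex.Im (x 0 i) - complex.Im z) ^+ 2.
  rewrite -big_split; apply: eq_bigr => i _ /=.
  by rewrite sqr_normcE !raddfB mulrDr.
have -> : \sum_(i < d) p i * Normc.normc (x 0 i) ^+ 2 =
    \sum_(i < d) p i * complex.Re (x 0 i) ^+ 2
    + \sum_(i < d) p i * complex.Im (x 0 i) ^+ 2.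
  by rewrite -big_split; apply: eq_bigr => i _ /=; rewrite sqr_normcE mulrDr.
rewrite splitE !sqr_normcE !raddfB /= ReE ImE !opprD.
rewrite addrACA -(weighted_sum_sqr_shift hp _ (complex.Re y)).
by rewrite -(weighted_sum_sqr_shift hp _ (complex.Im y)) addrACA.
Qed.

Lemma normc_le_max_dist (R : realType) d (x : 'rV[R[i]]_d) (y : R[i]) i :
  Normc.normc (x 0 i - y) <= max_dist x y.
Proof.
exact: (le_bigmax_cond _ (fun i : 'I_d => Normc.normc (x 0 i - y))).
Qed.

(** Dropping the subtracted square in [complex_varianceE] leaves an average of
    squared distances to y, at most the largest one; y is the optimal centre. *)
Lemma sqrt_variance_le_radius (R : realType) d (p : 'I_d -> R)
    (hp : is_distr p) (x : 'rV[R[i]]_d) :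
  Num.sqrt (complex_variance p x) <= enclosing_radius x.
Proof.
have [y ->] := enclosing_radius_attained x.
rewrite -(ger0_norm (max_dist_ge0 x y)) -sqrtr_sqr ler_wsqrtr //.
rewrite (complex_varianceE hp x y) lerBlDr.
apply: (@le_trans _ _ (max_dist x y ^+ 2)); last by rewrite lerDl sqr_ge0.
case: hp => p0 p1; rewrite -[leRHS]mul1r -p1 mulr_suml.
apply: ler_sum => i _; apply: ler_wpM2l => //.
by rewrite ler_sqr ?nnegrE ?normc_ge0 ?max_dist_ge0 ?normc_le_max_dist.
Qed.

(** The two largest moduli are given by positions in a sorted list; a
    permutation of the indices names the coordinates that attain them, and is
    what a permutation invariant norm can absorb. *)
Lemma decreasing_rearrangement (R : realType) d (x : 'rV[R[i]]_d.+2) :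
  exists s : 'S_d.+2,
    kyfan2 x =
      Normc.normc (x 0 (s ord0)) + Normc.normc (x 0 (s (lift ord0 ord0)))
    /\ forall i j : 'I_d.+2, (i <= j)%N ->
         Normc.normc (x 0 (s j)) <= Normc.normc (x 0 (s i)).
Proof.
rewrite /kyfan2; set l := [seq _ | _ : _].
have szl : size l == d.+2 by rewrite size_map -cardE card_ord.
have /tuple_permP[s hs] : perm_eq (sort >=%O l) (Tuple szl).
  by rewrite perm_sort.
have sE (i : 'I_d.+2) : (sort >=%O l)`_i = Normc.normc (x 0 (s i)).
  rewrite hs -tnth_nth tnth_mktuple (tnth_nth 0) /=.
  by rewrite (nth_map ord0) ?nth_ord_enum // -cardE card_ord.
exists s; split; first by rewrite -!sE.
move=> i j ij; rewrite -!sE.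
have := @sorted_leq_nth _ >=%O _ _ 0 (sort >=%O l) _ i j.
rewrite /= !inE size_sort (eqP szl) !ltn_ord; apply => //.
- by move=> a b c /= ba ca; exact: le_trans ca ba.
- exact: lexx.
- by apply: sort_sorted; move=> a b /=; exact: le_total.
Qed.

(** If z has the largest modulus a and b is the second largest, the centre
    (a - b)/2 z/|z| works: z is at distance a - (a - b)/2 from it and any other
    point at distance at most b + (a - b)/2. *)
Lemma radius_le_half_kyfan2 (R : realType) d (x : 'rV[R[i]]_d.+2) :
  enclosing_radius x <= 2^-1 * kyfan2 x.
Proof.
have [s [-> sP]] := decreasing_rearrangement x.
set i1 := lift _ _; set z := x 0 (s ord0).
set a := Normc.normc z; set b := Normc.normc _.
have ba : b <= a by exact: sP.
have b0 : 0 <= b by exact: normc_ge0.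
(* When a = 0 all the points are 0; division by 0 then gives t = 0, and the
   centre 0, as needed. *)
pose t := (a - b) / 2 / a.
have ta : t * a = (a - b) / 2.
  rewrite /t; have [a0|a0] := eqVneq a 0; last by rewrite divfK.
  by rewrite a0 mulr0; lra.
have t0 : 0 <= t by rewrite !divr_ge0 ?subr_ge0 ?ler0n ?normc_ge0.
have t1 : t <= 1.
  have [a0|a0] := eqVneq a 0; first by rewrite /t a0 invr0 mulr0.
  have ap : 0 < a by rewrite lt0r a0 (le_trans b0).
  by rewrite -(ler_pM2r ap) ta; lra.
apply: (le_trans (enclosing_radius_le x (t%:C * z))).
apply/bigmax_leP; split=> [|i _]; first by lra.
rewrite -(permKV s i); case: (unliftP ord0 ((s^-1)%g i)) => [k|] ->.
- have hk : Normc.normc (x 0 (s (lift ord0 k))) <= b by exact: sP.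
  apply: le_trans (normc_triangle _ _) _.
  by rewrite normc_opp Normc.normcM normc_real // -/a ta; lra.
(* z - t z = (1 - t) z, of modulus (1 - t) a since t <= 1. *)
- rewrite -/z -[X in X - _]mul1r -mulrBl -(rmorph1 (real_complex R)).
  by rewrite -rmorphB Normc.normcM normc_real ?subr_ge0 // mulrBl -/a ta; lra.
Qed.

Lemma vnorm_ge0 (R : realType) d (N : 'rV[R[i]]_d -> R) (hN : is_vnorm N) x :
  0 <= N x.
Proof.
have := vnormD hN x (-1 *: x).
have N0 : N 0 = 0 by rewrite -(scale0r x) (vnormZ hN) Normc.normc0 mul0r.
rewrite scaleN1r subrr N0 -scaleN1r (vnormZ hN) normc_opp Normc.normc1; lra.
Qed.

(** An absolute norm sees only the moduli: this is what makes sign changes of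
    single coordinates isometries. *)
Lemma absolute_eq (R : realType) d (N : 'rV[R[i]]_d -> R) (habs : absolute N)
    (x y : 'rV[R[i]]_d) :
  (forall i, Normc.normc (x 0 i) = Normc.normc (y 0 i)) -> N x = N y.
Proof.
move=> xy; rewrite -habs -[RHS]habs; congr N.
by apply/rowP => i; rewrite !mxE xy.
Qed.

(** Averaging over isometries: v differs from the vector u of moduli by signs
    off the first two coordinates, so u + v vanishes there, and adding its image
    under the exchange of the first two coordinates gives a multiple of F.  The
    triangle inequality bounds the norm of this sum of four vectors, each of
    norm N x, by 4 N x. *)
Lemma symmetric_gauge_ge_pair (R : realType) d (N : 'rV[R[i]]_d.+2 -> R)
    (hN : is_vnorm N) (hperm : perm_invariant N) (habs : absolute N)
    (x : 'rV[R[i]]_d.+2) :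
  2^-1 * (Normc.normc (x 0 ord0) + Normc.normc (x 0 (lift ord0 ord0)))
    * N (Fvec R d.+2) <= N x.
Proof.
set i1 := lift _ _; pose m k := Normc.normc (x 0 k).
have m0 k : 0 <= m k by exact: normc_ge0.
pose u : 'rV[R[i]]_d.+2 := \row_k (m k)%:C.
pose v : 'rV[R[i]]_d.+2 := \row_k (if (k < 2)%N then (m k)%:C else - (m k)%:C).
have Nu : N u = N x.
  by apply: absolute_eq => // k; rewrite mxE normc_real.
have Nv : N v = N x.
  apply: absolute_eq => // k; rewrite mxE.
  by case: ifP => _; rewrite ?normc_opp normc_real.
pose w := u + v.
have Nw : N w <= N x + N x by rewrite -{1}Nu -Nv; exact: vnormD.
have wF : w + col_perm (tperm ord0 i1) w
    = (2 * (m ord0 + m i1))%:C *: Fvec R d.+2.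
  apply/rowP => k; rewrite !mxE.
  case: (unliftP ord0 k) => [k'|] ->; last first.
    by rewrite tpermL /= mulr1 -!rmorphD /=; congr _%:C; ring.
  case: (unliftP ord0 k') => [k''|] ->; last first.
    by rewrite tpermR /= mulr1 -!rmorphD /=; congr _%:C; ring.
  by rewrite tpermD //= !subrr addr0 mulr0.
have := vnormD hN w (col_perm (tperm ord0 i1) w).
rewrite wF (vnormZ hN) hperm normc_real ?mulr_ge0 ?addr_ge0 // -/(m _) -/(m _).
by move: (N (Fvec _ _)) => f H; rewrite -mulrA -/(m i1); nra.
Qed.

Lemma half_kyfan2_le_symmetric_gauge (R : realType) d
    (N : 'rV[R[i]]_d.+2 -> R) (hN : is_vnorm N) (hperm : perm_invariant N)
    (habs : absolute N) (x : 'rV[R[i]]_d.+2) :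
  2^-1 * kyfan2 x <= N x / N (Fvec R d.+2).
Proof.
have NF : 0 < N (Fvec R d.+2).
  rewrite lt0r vnorm_ge0 // andbT; apply/eqP => /(vnorm_eq0 hN)/rowP/(_ ord0).
  by rewrite !mxE; apply/eqP; exact: oner_neq0.
have [s [-> _]] := decreasing_rearrangement x.
rewrite ler_pdivlMr // -(hperm s x).
by have := symmetric_gauge_ge_pair hN hperm habs (col_perm s x); rewrite !mxE.
Qed.

Theorem theorem7 (R : realType) (d : nat) (hd : (2 <= d)%N)
    (p : 'I_d -> R) (hp : is_distr p) (x : 'rV[R[i]]_d)
    (N : 'rV[R[i]]_d -> R) (hN : is_vnorm N)
    (hperm : perm_invariant N) (habs : absolute N) :
  [/\ Num.sqrt (complex_variance p x) <= enclosing_radius x,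
      enclosing_radius x <= 2^-1 * kyfan2 x
    & 2^-1 * kyfan2 x <= N x / N (Fvec R d)].
Proof.
case: d hd => [|[|d]] // _ in p hp x N hN hperm habs *.
split; first exact: sqrt_variance_le_radius.
  exact: radius_le_half_kyfan2.
exact: half_kyfan2_le_symmetric_gauge.
Qed.
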